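(* Let $\omega:[1,\infty)\to\mathbb{R}$ be the Buchstab function and, for each integer $j\ge 2$, let $\omega_j$ denote the restriction of $\omega$ to $[j,j+1]$. Define real numbers $a_k(j)$ (for integers $k\ge 0$, $j\ge 2$) recursively by $$a_k(2) = (-1)^{k+1}\left(-\frac{1+\log\left(\frac32\right)}{(5/2)^{k+1}}+\frac35\left(\frac23\right)^{k+1}\sum_{m=0}^{k-1}\frac{1}{k-m}\left(\frac35\right)^m\right)\qquad (k\ge 0),$$ $$a_0(j)=\frac{1}{j+1/2}\sum_{k=0}^\infty \frac{a_k(j-1)}{2^k}\left(j+\frac{(-1)^k}{2(k+1)}\right)\qquad (j\ge 3),$$ $$a_k(j)=\frac{1}{j+1/2}\left(\frac{a_{k-1}(j-1)}{k}-a_{k-1}(j)\right)\qquad (j\ge 3,\ k\ge 1),$$ where the empty sum (for $k=0$ in the first formula) is $0$. Then for every integer $j\ge 2$ and every $u\in[j,j+1]$, $$\omega_j(u)=\sum_{k=0}^\infty a_k(j)\,\bigl(u-(j+1/2)\bigr)^k .$$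
   Context: The Buchstab function $\omega:[1,\infty)\to\mathbb{R}$ is the continuous function determined by the delay differential equation $\omega(u)=1/u$ for $1\le u\le 2$ and $(u\,\omega(u))'=\omega(u-1)$ for $u\ge 2$ (the derivative at $u=2$ being understood as one-sided from the right). In particular $\omega(u)=\frac{\log(u-1)+1}{u}$ for $2\le u\le 3$. Here $\log$ is the natural logarithm. Part of the assertion is that the infinite series defining $a_0(j)$ and the power series converge. *)

(* Defs.v *)
From Stdlib Require Import Reals Lia.
From Coquelicot Require Import Coquelicot.
Open Scope R_scope.

Definition is_right_derive (f : R -> R) (x l : R) : Prop :=
  filterlim (fun y => (f y - f x) / (y - x)) (at_right x) (locally l).

(* [w] is a total function, but only its values on [1, +oo) are constrained;
   on that half-line these conditions determine it uniquely. At [u = 2] the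
   function [u * w u] has a corner, so only its right derivative is prescribed. *)
Definition is_buchstab (w : R -> R) : Prop :=
  continuous_on (fun u => 1 <= u) w /\
  (forall u, 1 <= u <= 2 -> w u = 1 / u) /\
  is_right_derive (fun u => u * w u) 2 (w (2 - 1)) /\
  (forall u, 2 < u -> is_derive (fun t => t * w t) u (w (u - 1))).

(* The sum over [0 <= m <= k - 1]; [sum_n] includes its upper bound, hence the
   case distinction for the empty sum. *)
Definition coeff2_sum (k : nat) : R :=
  match k with
  | O => 0
  | S k' => sum_n (fun m => 1 / (INR k - INR m) * (3 / 5) ^ m) k'
  end.

Definition coeff2 (k : nat) : R :=
  (-1) ^ (k + 1) *
  (- ((1 + ln (3 / 2)) / (5 / 2) ^ (k + 1))
   + 3 / 5 * (2 / 3) ^ (k + 1) * coeff2_sum k).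

(* General term of the series for [a_0(j)], where [b k] stands for
   [a_k(j - 1)]. *)
Definition coeff0_term (j : nat) (b : nat -> R) (k : nat) : R :=
  b k / 2 ^ k * (INR j + (-1) ^ k / (2 * (INR k + 1))).

(* Passage from [b k = a_k(j - 1)] to [a_k(j)]. *)
Fixpoint coeff_step (j : nat) (b : nat -> R) (k : nat) : R :=
  match k with
  | O => 1 / (INR j + 1 / 2) * Series (coeff0_term j b)
  | S k' => 1 / (INR j + 1 / 2) * (b k' / INR k - coeff_step j b k')
  end.

(* [coeff j k] is [a_k(j)]; the values for [j < 2] are junk. *)
Fixpoint coeff (j : nat) : nat -> R :=
  match j with
  | S (S (S _) as j') => coeff_step j (coeff j')
  | _ => coeff2
  end.

Lemma coeff_2 (k : nat) : coeff 2 k = coeff2 k.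
Proof. reflexivity. Qed.

Lemma coeff_0 (j : nat) : (3 <= j)%nat ->
  coeff j 0 = 1 / (INR j + 1 / 2) *
    Series (fun k => coeff (j - 1) k / 2 ^ k *
                     (INR j + (-1) ^ k / (2 * (INR k + 1)))).
Proof.
  intros H; destruct j as [|[|[|j]]]; try lia.
  reflexivity.
Qed.

Lemma coeff_S (j k : nat) : (3 <= j)%nat -> (1 <= k)%nat ->
  coeff j k = 1 / (INR j + 1 / 2) *
    (coeff (j - 1) (k - 1) / INR k - coeff j (k - 1)).
Proof.
  intros H Hk; destruct j as [|[|[|j]]]; try lia.
  destruct k as [|k]; [inversion Hk|].
  replace (S k - 1)%nat with k by lia.
  reflexivity.
Qed.

(* Main.v *)
Require Import Defs.
From Stdlib Require Import Reals Lra Lia.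
From Coquelicot Require Import Coquelicot.
Open Scope R_scope.

(** The idea is to integrate [(u * w u)' = w (u - 1)] termwise, one unit
    interval at a time. Put [c = j + 1/2], [f x = w (c + x)] and let [b] be the
    coefficients of [w] about [c - 1]. Then [(c + x) * f x] is an antiderivative
    of [sum b_k x^k], and comparing coefficients of [x^(k+1)] gives

      [c * a_(k+1) + a_k = b_k / (k+1)],

    which is [integration_step]. Its solutions are determined by [a_0], that
    is, by the constant of integration. The formula for [a_0(j)] is the
    condition that the antiderivative has the value [j * w j] at [x = -1/2],
    where [w j] is given by the previous series at its right end [x = 1/2]
    ([PSeries_left_end]). Since [w] is continuous, agreement of the derivatives
    and of the values at the left end gives agreement on [[j, j + 1]]
    ([buchstab_step]).

    The step also covers the first interval: on [[1, 2]] the function is [1/u],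
    with the geometric coefficients [reciprocal_coeff] about [3/2], and the
    closed formula for [a_k(2)] satisfies [integration_step] with respect to
    them. Only the constant of integration is fixed differently there, by
    comparison with [1 + ln (3/2 + x)] ([PSeries_coeff2_left_end]).

    Convergence comes from a crude bound: for [c >= 2] an integration step
    preserves boundedness of coefficient sequences, so all series have radius
    of convergence at least [1], while they are used on [[-1/2, 1/2]]. *)

(** * Power series with bounded coefficients *)

Definition bounded_seq (a : nat -> R) : Prop :=
  exists M, forall k, Rabs (a k) <= M.

Lemma bounded_lt_CV_radius (a : nat -> R) (x : R) :
  bounded_seq a -> Rabs x < 1 -> Rbar_lt (Rabs x) (CV_radius a).
Proof.
  intros [M HM] Hx.
  apply Rbar_lt_le_trans with (Finite 1); [exact Hx|].
  apply (proj1 (CV_radius_bounded a)).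
  exists M; intros n; rewrite pow1, Rmult_1_r; apply HM.
Qed.

Lemma bounded_ex_pseries (a : nat -> R) (x : R) :
  bounded_seq a -> Rabs x < 1 -> ex_pseries a x.
Proof.
  intros Ha Hx; apply CV_radius_inside, bounded_lt_CV_radius; assumption.
Qed.

Lemma bounded_ex_series (a : nat -> R) (x : R) :
  bounded_seq a -> Rabs x < 1 -> ex_series (fun k => a k * x ^ k).
Proof.
  intros Ha Hx; apply ex_series_Rabs, CV_disk_inside, bounded_lt_CV_radius;
    assumption.
Qed.

(** * The coefficient recursion as an integration *)

Definition integration_step (c : R) (b a : nat -> R) : Prop :=
  forall k, a (S k) = 1 / c * (b k / INR (S k) - a k).

(** Coefficients of [(c + x) * sum a_k x^k]. *)
Definition affine_mult (c : R) (a : nat -> R) : nat -> R :=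
  PS_plus (PS_scal c a) (PS_incr_1 a).

Lemma PSeries_affine_mult (c : R) (a : nat -> R) (x : R) :
  bounded_seq a -> Rabs x < 1 ->
  PSeries (affine_mult c a) x = (c + x) * PSeries a x.
Proof.
  intros Ha Hx; unfold affine_mult.
  assert (He : ex_pseries a x) by (apply bounded_ex_pseries; assumption).
  rewrite PSeries_plus.
  - rewrite PSeries_scal, PSeries_incr_1; ring.
  - apply ex_pseries_scal; [apply Rmult_comm | exact He].
  - apply ex_pseries_incr_1, He.
Qed.

Lemma affine_mult_0 (c : R) (a : nat -> R) : affine_mult c a 0 = c * a 0%nat.
Proof.
  unfold affine_mult, PS_plus, PS_scal, PS_incr_1, plus, scal, zero; simpl.
  unfold mult; simpl; ring.
Qed.

Lemma affine_mult_S (c : R) (b a : nat -> R) (k : nat) :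
  c <> 0 -> integration_step c b a -> affine_mult c a (S k) = b k / INR (S k).
Proof.
  intros Hc Hs.
  unfold affine_mult, PS_plus, PS_scal, PS_incr_1, plus, scal.
  cbn -[INR]; unfold mult; cbn -[INR].
  rewrite Hs; field; split; [apply not_0_INR; lia | exact Hc].
Qed.

Lemma Rabs_div_INR_S_le (x M : R) (k : nat) :
  Rabs x <= M -> Rabs (x / INR (S k)) <= M.
Proof.
  intros Hx.
  assert (Hk : 1 <= INR (S k)) by (rewrite S_INR; generalize (pos_INR k); lra).
  unfold Rdiv; rewrite Rabs_mult, Rabs_inv, (Rabs_pos_eq (INR (S k))) by lra.
  apply Rle_trans with (Rabs x * 1); [|lra].
  apply Rmult_le_compat_l; [apply Rabs_pos|].
  rewrite <- Rinv_1; apply Rinv_le_contravar; lra.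
Qed.

(** Each new coefficient is at most [(|b_k| + |a_k|) / 2], the mean of two
    numbers that do not exceed the bound. *)
Lemma integration_step_bounded (c : R) (b a : nat -> R) :
  2 <= c -> integration_step c b a -> bounded_seq b -> bounded_seq a.
Proof.
  intros Hc Hs [M HM].
  exists (Rmax (Rabs (a 0%nat)) M).
  induction k as [|k IH]; [apply Rmax_l|].
  rewrite Hs, Rabs_mult, (Rabs_pos_eq (1 / c))
    by (apply Rlt_le, Rdiv_lt_0_compat; lra).
  assert (Hb := Rabs_div_INR_S_le _ _ k (HM k)).
  assert (HMm := Rmax_r (Rabs (a 0%nat)) M).
  assert (Hd : Rabs (b k / INR (S k) - a k)
               <= Rabs (b k / INR (S k)) + Rabs (a k)).
  { unfold Rminus; rewrite <- (Rabs_Ropp (a k)); apply Rabs_triang. }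
  apply Rle_trans with (1 / 2 * Rabs (b k / INR (S k) - a k)); [|lra].
  apply Rmult_le_compat_r; [apply Rabs_pos|].
  unfold Rdiv; rewrite !Rmult_1_l; apply Rinv_le_contravar; lra.
Qed.

Lemma affine_mult_bounded (c : R) (b a : nat -> R) :
  c <> 0 -> integration_step c b a -> bounded_seq b ->
  bounded_seq (affine_mult c a).
Proof.
  intros Hc Hs [M HM].
  exists (Rmax (Rabs (c * a 0%nat)) M); intros [|k].
  - rewrite affine_mult_0; apply Rmax_l.
  - rewrite (affine_mult_S c b) by assumption.
    eapply Rle_trans; [apply Rabs_div_INR_S_le, HM | apply Rmax_r].
Qed.

(** The recursion says exactly that the formal derivative of
    [affine_mult c a] is [b]. *)
Lemma is_derive_affine_PSeries (c : R) (b a : nat -> R) (x : R) :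
  2 <= c -> integration_step c b a -> bounded_seq b -> Rabs x < 1 ->
  is_derive (fun t => (c + t) * PSeries a t) x (PSeries b x).
Proof.
  intros Hc Hs Hb Hx.
  assert (Ha : bounded_seq a) by (eapply integration_step_bounded; eauto).
  apply is_derive_ext_loc with (PSeries (affine_mult c a)).
  - assert (Hd : 0 < 1 - Rabs x) by lra.
    exists (mkposreal _ Hd); intros y Hy.
    apply PSeries_affine_mult; [exact Ha|].
    change (Rabs (y - x) < 1 - Rabs x) in Hy.
    replace y with ((y - x) + x) by ring.
    eapply Rle_lt_trans; [apply Rabs_triang|]; lra.
  - rewrite <- (PSeries_ext (PS_derive (affine_mult c a))).
    + apply is_derive_PSeries, bounded_lt_CV_radius; [|exact Hx].
      apply affine_mult_bounded with b; [lra|assumption..].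
    + intros n; unfold PS_derive.
      rewrite (affine_mult_S c b) by (assumption || lra).
      field; apply not_0_INR; lia.
Qed.

(** The factor in parentheses is bounded, so this is a power series with
    bounded coefficients at [1/2]. *)
Lemma ex_series_initial_value (j : R) (b : nat -> R) :
  0 <= j -> bounded_seq b ->
  ex_series (fun k => b k / 2 ^ k * (j + (-1) ^ k / (2 * (INR k + 1)))).
Proof.
  intros Hj [M HM].
  apply (ex_series_ext
    (fun k => (b k * (j + (-1) ^ k / (2 * (INR k + 1)))) * (1 / 2) ^ k)).
  { intros k; unfold Rdiv; rewrite Rmult_1_l, pow_inv.
    (* [ring] has to see the carrier of the normed module as [R]. *)
    match goal with |- ?x = ?y => change (@eq R x y) end; ring. }
  apply (bounded_ex_series (fun k => b k * (j + (-1) ^ k / (2 * (INR k + 1))))).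
  - exists (M * (j + 1)); intros k.
    rewrite Rabs_mult.
    apply Rmult_le_compat; [apply Rabs_pos | apply Rabs_pos | apply HM |].
    eapply Rle_trans; [apply Rabs_triang|].
    rewrite (Rabs_pos_eq j Hj).
    apply Rplus_le_compat_l.
    assert (Hk := pos_INR k).
    unfold Rdiv; rewrite Rabs_mult, pow_1_abs, Rmult_1_l, Rabs_pos_eq.
    + rewrite <- Rinv_1; apply Rinv_le_contravar; lra.
    + apply Rlt_le, Rinv_0_lt_compat; lra.
  - rewrite Rabs_pos_eq; lra.
Qed.

(** With [j = c - 1/2], the hypothesis on [c * a_0] reads
    [c * a_0 = j * f (1/2) + F 0 - F (-1/2)], where [f] is the sum of the series
    [b] and [F] an antiderivative of it: the term [(-1)^k / (2^(k+1) (k+1))] is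
    the integral of [x^k] over [[-1/2, 0]]. As [(c + x) * sum a_k x^k] is such
    an [F] with [F 0 = c * a_0], it takes the value [j * f (1/2)] at [-1/2],
    where the factor [c + x] equals [j]. *)
Lemma PSeries_left_end (c : R) (b a : nat -> R) :
  2 <= c -> integration_step c b a -> bounded_seq b ->
  c * a 0%nat
    = Series (fun k => b k / 2 ^ k * (c - 1 / 2 + (-1) ^ k / (2 * (INR k + 1)))) ->
  PSeries a (- (1 / 2)) = PSeries b (1 / 2).
Proof.
  intros Hc Hs Hb H0.
  assert (Ha : bounded_seq a) by (eapply integration_step_bounded; eauto).
  assert (Hh : Rabs (- (1 / 2)) < 1) by (rewrite Rabs_Ropp, Rabs_pos_eq; lra).
  assert (Hp : bounded_seq (affine_mult c a))
    by (apply affine_mult_bounded with b; [lra|assumption..]).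
  assert (E := PSeries_affine_mult c a _ Ha Hh).
  assert (Hx : ex_series (fun k => affine_mult c a k * (- (1 / 2)) ^ k))
    by (apply bounded_ex_series; assumption).
  (* The constant term of the product is split off, so that the two series can
     be added and compared term by term with [b]. *)
  unfold PSeries at 1 in E.
  rewrite Series_incr_1 in E by exact Hx.
  rewrite affine_mult_0, H0, pow_O, Rmult_1_r, <- Series_plus in E.
  - apply Rmult_eq_reg_l with (c - 1 / 2); [|lra].
    transitivity ((c + - (1 / 2)) * PSeries a (- (1 / 2))); [reflexivity|].
    rewrite <- E; unfold PSeries; rewrite <- Series_scal_l.
    apply Series_ext; intros k.
    rewrite (affine_mult_S c b) by (assumption || lra).
    rewrite S_INR.
    replace (- (1 / 2)) with (-1 * / 2) by field.
    replace (1 / 2) with (/ 2) by field.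
    rewrite Rpow_mult_distr, !pow_inv; simpl pow.
    field; split; [apply pow_nonzero; lra | generalize (pos_INR k); lra].
  - apply ex_series_initial_value; [lra | exact Hb].
  - apply (ex_series_incr_1 (fun k => affine_mult c a k * (- (1 / 2)) ^ k)), Hx.
Qed.

(** * From one unit interval to the next *)

Lemma eq_left_of_derive_0 (f : R -> R) (l r x : R) :
  (forall t, l <= t <= r -> continuity_pt f t) ->
  (forall t, l < t < r -> is_derive f t 0) ->
  l <= x <= r -> f x = f l.
Proof.
  intros Hc Hd Hx.
  destruct (MVT_gen f l x (fun _ => 0)) as [t [_ Ht]].
  - intros t; rewrite Rmin_left, Rmax_right by lra; intros Ht; apply Hd; lra.
  - intros t; rewrite Rmin_left, Rmax_right by lra; intros Ht; apply Hc; lra.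
  - lra.
Qed.

Lemma buchstab_continuity_pt (w : R -> R) (u : R) :
  is_buchstab w -> 1 < u -> continuity_pt w u.
Proof.
  intros [Hw _] Hu.
  apply continuity_pt_filterlim; intros P HP.
  assert (Hin := Hw u (Rlt_le _ _ Hu) P HP).
  assert (Hloc : locally u (fun t => 1 < t)) by (apply open_gt, Hu).
  unfold filtermap, within in *.
  generalize (filter_and _ _ Hin Hloc); apply filter_imp.
  intros t [Ht H1]; apply Ht, Rlt_le, H1.
Qed.

Lemma is_derive_shift_affine_PSeries (c : R) (b a : nat -> R) (u : R) :
  2 <= c -> integration_step c b a -> bounded_seq b -> Rabs (u - c) < 1 ->
  is_derive (fun t => t * PSeries a (t - c)) u (PSeries b (u - c)).
Proof.
  intros Hc Hs Hb Hu.
  apply is_derive_ext with (fun t => (c + (t - c)) * PSeries a (t - c)).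
  { intros t; f_equal; ring. }
  rewrite <- (Rmult_1_l (PSeries b (u - c))).
  apply (is_derive_comp (fun t => (c + t) * PSeries a t) (fun t => t - c)).
  - apply is_derive_affine_PSeries; assumption.
  - auto_derive; [exact I | ring].
Qed.

(** Both [u * w u] and [u] times the new series have derivative [w (u - 1)]
    inside the interval and the same value at [u = j]. The derivatives are
    compared on the open interval only, because [u * w u] has a corner at
    [u = 2]. *)
Lemma buchstab_step (w : R -> R) (j : R) (b a : nat -> R) :
  is_buchstab w -> 2 <= j ->
  integration_step (j + 1 / 2) b a -> bounded_seq b ->
  (forall u, j - 1 <= u <= j -> w u = PSeries b (u - (j - 1 / 2))) ->
  w j = PSeries a (- (1 / 2)) ->
  forall u, j <= u <= j + 1 -> w u = PSeries a (u - (j + 1 / 2)).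
Proof.
  intros Hw Hj Hs Hb Hprev Hleft u Hu.
  set (g := fun t => t * PSeries a (t - (j + 1 / 2))).
  assert (Hdg : forall t, j <= t <= j + 1 ->
            is_derive g t (PSeries b (t - (j + 1 / 2)))).
  { intros t Ht; apply is_derive_shift_affine_PSeries; try assumption; [lra|].
    apply Rabs_def1; lra. }
  assert (E : u * w u - g u = j * w j - g j).
  { apply (eq_left_of_derive_0 (fun t => t * w t - g t) j (j + 1)); [| |exact Hu].
    - intros t Ht; apply continuity_pt_minus.
      + apply continuity_pt_mult; [apply continuity_pt_id|].
        apply buchstab_continuity_pt; [exact Hw | lra].
      + apply derivable_continuous_pt.
        exists (PSeries b (t - (j + 1 / 2))); apply is_derive_Reals, Hdg, Ht.
    - intros t Ht.
      destruct Hw as (_ & _ & _ & Hw).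
      replace 0 with (w (t - 1) - PSeries b (t - (j + 1 / 2))).
      + apply (is_derive_minus (fun t => t * w t) g); [apply Hw | apply Hdg]; lra.
      + rewrite Hprev by lra.
        replace (t - 1 - (j - 1 / 2)) with (t - (j + 1 / 2)) by lra; ring. }
  unfold g in E; rewrite Hleft in E.
  replace (j - (j + 1 / 2)) with (- (1 / 2)) in E by lra.
  apply Rmult_eq_reg_l with u; lra.
Qed.

(** * The first interval *)

(** Taylor coefficients of [1/u] about [u = 3/2]. *)
Definition reciprocal_coeff (k : nat) : R := (-1) ^ k * (2 / 3) ^ (k + 1).

Lemma reciprocal_coeff_bounded : bounded_seq reciprocal_coeff.
Proof.
  exists 1; intros k; unfold reciprocal_coeff.
  rewrite Rabs_mult, pow_1_abs, Rmult_1_l, Rabs_pos_eq by (apply pow_le; lra).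
  rewrite <- (pow1 (k + 1)); apply pow_incr; lra.
Qed.

Lemma PSeries_reciprocal (x : R) :
  Rabs x < 1 -> PSeries reciprocal_coeff x = / (3 / 2 + x).
Proof.
  intros Hx; apply Rabs_def2 in Hx.
  unfold PSeries.
  rewrite (Series_ext _ (fun k => 2 / 3 * (- (2 / 3) * x) ^ k)).
  - rewrite Series_scal_l, Series_geom by (apply Rabs_def1; lra).
    field; lra.
  - intros k; unfold reciprocal_coeff.
    replace (- (2 / 3) * x) with (-1 * (2 / 3) * x) by ring.
    rewrite !Rpow_mult_distr, pow_add, pow_1; ring.
Qed.

Lemma coeff2_sum_S (k : nat) :
  coeff2_sum (S k) = 1 / INR (S k) + 3 / 5 * coeff2_sum k.
Proof.
  destruct k as [|k].
  - unfold coeff2_sum; rewrite sum_O; simpl; field.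
  - unfold coeff2_sum, sum_n.
    rewrite sum_Sn_m by lia.
    rewrite <- sum_n_m_S, <- (sum_n_m_mult_l (K := R_Ring)).
    unfold plus; cbn -[INR sum_n_m].
    f_equal.
    + rewrite Rminus_0_r; ring.
    + apply sum_n_m_ext; intros n; unfold mult; cbn -[INR].
      rewrite (S_INR (S k)), (S_INR n).
      replace (INR (S k) + 1 - (INR n + 1)) with (INR (S k) - INR n) by ring.
      ring.
Qed.

(** The closed formula for [a_k(2)] is thus the general step from the interval
    [[1, 2]]. *)
Lemma coeff2_integration_step :
  integration_step (2 + 1 / 2) reciprocal_coeff coeff2.
Proof.
  intros k; unfold coeff2, reciprocal_coeff.
  rewrite coeff2_sum_S.
  assert (Hk : INR (S k) <> 0) by (apply not_0_INR; lia).
  rewrite !Nat.add_1_r.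
  unfold Rdiv; rewrite !Rpow_mult_distr, !pow_inv; simpl pow.
  field; repeat split; try exact Hk; apply pow_nonzero; lra.
Qed.

Lemma coeff2_bounded : bounded_seq coeff2.
Proof.
  apply (integration_step_bounded (2 + 1 / 2) reciprocal_coeff);
    [lra | apply coeff2_integration_step | apply reciprocal_coeff_bounded].
Qed.

(** The function [(5/2 + x) * sum a_k(2) x^k] has derivative [1 / (3/2 + x)] and
    value [1 + ln (3/2)] at [0], so it is [1 + ln (3/2 + x)], which equals [1] at
    [-1/2]; there the factor [5/2 + x] is [2]. *)
Lemma PSeries_coeff2_left_end : PSeries coeff2 (- (1 / 2)) = 1 / 2.
Proof.
  set (g := fun x => (2 + 1 / 2 + x) * PSeries coeff2 x - ln (3 / 2 + x)).
  assert (Hd : forall x, - (1 / 2) <= x <= 0 -> is_derive g x 0).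
  { intros x Hx.
    assert (Hx1 : Rabs x < 1) by (apply Rabs_def1; lra).
    replace 0 with (PSeries reciprocal_coeff x - / (3 / 2 + x))
      by (rewrite PSeries_reciprocal by exact Hx1; ring).
    apply (is_derive_minus (fun x => (2 + 1 / 2 + x) * PSeries coeff2 x)
             (fun x => ln (3 / 2 + x))).
    - apply is_derive_affine_PSeries; try exact Hx1; try lra;
        [apply coeff2_integration_step | apply reciprocal_coeff_bounded].
    - auto_derive; [lra | field; lra]. }
  assert (E : g 0 = g (- (1 / 2))).
  { apply (eq_left_of_derive_0 g (- (1 / 2)) 0); [| |lra].
    - intros x Hx; apply derivable_continuous_pt.
      exists 0; apply is_derive_Reals, Hd, Hx.
    - intros x Hx; apply Hd; lra. }
  unfold g in E.
  replace (3 / 2 + - (1 / 2)) with 1 in E by field.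
  rewrite ln_1, PSeries_0, !Rplus_0_r in E.
  replace (coeff2 0) with ((1 + ln (3 / 2)) / (5 / 2)) in E
    by (unfold coeff2; simpl; field).
  lra.
Qed.

(** * All intervals *)

Lemma coeff_integration_step (j : nat) : (3 <= j)%nat ->
  integration_step (INR j + 1 / 2) (coeff (j - 1)) (coeff j).
Proof.
  intros Hj k.
  rewrite coeff_S by lia.
  replace (S k - 1)%nat with k by lia; reflexivity.
Qed.

Lemma coeff_bounded (j : nat) : (2 <= j)%nat -> bounded_seq (coeff j).
Proof.
  induction 1 as [|j Hj IH]; [exact coeff2_bounded|].
  apply (integration_step_bounded (INR (S j) + 1 / 2) (coeff (S j - 1))).
  - apply le_INR in Hj; rewrite S_INR; simpl in Hj; lra.
  - apply coeff_integration_step; lia.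
  - replace (S j - 1)%nat with j by lia; exact IH.
Qed.

Lemma buchstab_PSeries (w : R -> R) (j : nat) :
  is_buchstab w -> (2 <= j)%nat ->
  forall u, INR j <= u <= INR j + 1 ->
  w u = PSeries (coeff j) (u - (INR j + 1 / 2)).
Proof.
  intros Hw; induction 1 as [|j Hj IH].
  - replace (INR 2) with 2 by (simpl; ring).
    assert (Hw12 : forall u, 1 <= u <= 2 -> w u = 1 / u) by apply Hw.
    apply (buchstab_step w 2 reciprocal_coeff); [exact Hw | lra | | | |].
    + exact coeff2_integration_step.
    + exact reciprocal_coeff_bounded.
    + intros u Hu.
      rewrite PSeries_reciprocal by (apply Rabs_def1; lra).
      rewrite Hw12 by lra.
      replace (3 / 2 + (u - (2 - 1 / 2))) with u by lra; field; lra.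
    + rewrite Hw12 by lra; symmetry; exact PSeries_coeff2_left_end.
  - assert (Hj2 : 2 <= INR j) by (apply le_INR in Hj; simpl in Hj; lra).
    assert (Hstep := coeff_integration_step (S j) ltac:(lia)).
    assert (H0 := coeff_0 (S j) ltac:(lia)).
    replace (S j - 1)%nat with j in * by lia.
    assert (Hb := coeff_bounded j Hj).
    assert (HS := S_INR j).
    apply (buchstab_step w (INR (S j)) (coeff j)); try assumption; [lra| |].
    + intros u Hu; rewrite IH by lra; f_equal; lra.
    + rewrite (PSeries_left_end (INR (S j) + 1 / 2) (coeff j)); try assumption.
      * rewrite IH by lra; f_equal; lra.
      * lra.
      * rewrite H0.
        replace (INR (S j) + 1 / 2 - 1 / 2) with (INR (S j)) by ring.
        field; lra.
Qed.

Theorem mainTheorem1 :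
  (forall j : nat, (3 <= j)%nat ->
     ex_series (fun k : nat => coeff (j - 1) k / 2 ^ k *
                 (INR j + (-1) ^ k / (2 * (INR k + 1))))) /\
  (forall w : R -> R, is_buchstab w ->
   forall (j : nat) (u : R), (2 <= j)%nat -> INR j <= u <= INR j + 1 ->
     is_series (fun k : nat => coeff j k * (u - (INR j + 1 / 2)) ^ k) (w u)).
Proof.
  split.
  - intros j Hj.
    apply ex_series_initial_value; [apply pos_INR | apply coeff_bounded; lia].
  - intros w Hw j u Hj Hu.
    rewrite (buchstab_PSeries w j Hw Hj u Hu).
    apply is_pseries_R, PSeries_correct, bounded_ex_pseries.
    + apply coeff_bounded, Hj.
    + apply Rabs_def1; lra.
Qed.
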